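(* Let $C$ be a smooth curve of genus $g$ and $P\in C$ a point with first (smallest positive) non-gap $a$, such that the first non-gap $b$ of $P$ that is not a multiple of $a$ is $b=na+r$ with $n\geq 1$, $0<r<a$; assume $\gcd(a,b)=1$, $\dim|(n+1)aP|=n+2$ and $g=(a-1)(b-a+r)/2$. Assume $C$ has a Weierstrass point $Q\neq P$ such that $a$ and $b$ are non-gaps of $Q$ and $aQ\in|aP|$. Then $\mathrm{WS}(P)=\mathrm{WS}(Q)$, and both are equal to the union $\langle a;b\rangle\cup T$ of $\langle a;b\rangle$ and the set $T$ of trivial new non-gaps associated to a cusp of type $(a-r;a)$.
   Context: Curves are smooth, irreducible, projective, over $\mathbb{C}$. For a point $P\in C$, $\mathrm{WS}(P)=\{0\}\cup\{m\in\mathbb{N}: |mP| \text{ is base point free}\}$, and its elements are the non-gaps of $P$; $P$ is a Weierstrass point if $\mathbb{N}\setminus\mathrm{WS}(P)\neq\{1,\dots,g\}$. $\langle a;b\rangle\subseteq\mathbb{N}$ is the semigroup generated by $a,b$. $|D|$ is the complete linear system of $D$ and $\dim|D|$ its projective dimension. Trivial new non-gaps: set $\mu=a-r$ (so $\gcd(a,\mu)=1$). For each integer $1\leq m\leq\mu-1$ let $n(m)$ be the integer with $(n(m)-1)\mu<ma<n(m)\mu$ (then $n(m)<a$). Then $T=\{\,ib-ma : 1\leq m\leq\mu-1,\ n(m)\leq i\leq a-1\,\}$. *)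

(* Defs.v *)
From HB Require Import structures.
From mathcomp Require Import all_boot all_order all_algebra.
From mathcomp Require Export freeg mpoly complex.
From mathcomp Require Export classical_sets reals.

Set Implicit Arguments.
Unset Strict Implicit.
Unset Printing Implicit Defensive.

Import Order.TTheory GRing.Theory Num.Theory.
Local Open Scope classical_set_scope.
Local Open Scope ring_scope.

Section ProjectiveSpace.
Variables (k : closedFieldType) (N : nat).

(* Points of P^N are the lines of k^(N+1). *)
Definition proj_point := {L : {vspace 'rV[k]_N.+1} | \dim L == 1%N}.

(* Value at the representative [vpick] of p. For homogeneous F, whether it is
   zero does not depend on the representative, nor does the ratio of two values
   of forms of the same degree. *)
Definition pt_eval (p : proj_point) (F : {mpoly k[N.+1]}) : k :=
  F.@[fun i => vpick (val p) ord0 i].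

Definition zero_locus (eqs : seq {mpoly k[N.+1]}) :=
  {p : proj_point | all (fun F => pt_eval p F == 0) eqs}.

End ProjectiveSpace.

(* An irreducible closed subset V(eqs) of P^N, given with its function field.
   [pv_gen] are the homogeneous coordinates of the generic point: a form
   vanishes at it iff it vanishes on V(eqs). Hence the homogeneous ideal of
   V(eqs) is prime (i.e. V(eqs) is irreducible and nonempty), and by [pv_fracP]
   the field [pv_field] is exactly the field of the fractions F/G of forms of the
   same degree with G not in the ideal, modulo F/G = F'/G' iff FG' - F'G is in
   the ideal. *)
Record projVariety (k : closedFieldType) := ProjVariety {
  pv_amb : nat;
  pv_eqs : seq {mpoly k[pv_amb.+1]};
  pv_field : fieldType;
  pv_const : {rmorphism k -> pv_field};
  pv_gen : 'I_pv_amb.+1 -> pv_field;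
  pv_eqs_homog : forall F, F \in pv_eqs -> exists d : nat, F \is d.-homog;
  pv_genP : forall (d : nat) (F : {mpoly k[pv_amb.+1]}), F \is d.-homog ->
    (mmap pv_const pv_gen F = 0 <->
     forall p : zero_locus pv_eqs, pt_eval (val p) F = 0);
  pv_fracP : forall f : pv_field, exists (d : nat) (F G : {mpoly k[pv_amb.+1]}),
    [/\ F \is d.-homog, G \is d.-homog, mmap pv_const pv_gen G != 0
      & f = mmap pv_const pv_gen F / mmap pv_const pv_gen G]
}.

Section Variety.
Variables (k : closedFieldType) (X : projVariety k).

Local Notation K := (pv_field X).
Local Notation cst := (pv_const X).
Local Notation gen F := (mmap (pv_const X) (@pv_gen k X) F).

Definition point := zero_locus (pv_eqs X).

Definition alg_indep (d : nat) (v : 'I_d -> K) : Prop :=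
  forall F : {mpoly k[d]}, mmap cst v F = 0 -> F = 0.

(* dim X = d, as the transcendence degree of the function field *)
Definition has_dim (d : nat) : Prop :=
  (exists v : 'I_d -> K, alg_indep v) /\
  (forall v : 'I_d.+1 -> K, ~ alg_indep v).

Definition local_ring (p : point) : set K :=
  [set f | exists (d : nat) (F G : {mpoly k[(pv_amb X).+1]}),
    [/\ F \is d.-homog, G \is d.-homog, pt_eval (val p) G != 0
      & f = gen F / gen G]].

Definition max_ideal (p : point) : set K :=
  [set f | exists (d : nat) (F G : {mpoly k[(pv_amb X).+1]}),
    [/\ F \is d.-homog, G \is d.-homog, pt_eval (val p) F = 0,
        pt_eval (val p) G != 0 & f = gen F / gen G]].

Definition max_ideal_sq (p : point) : set K :=
  [set f | exists (s : nat) (g h : 'I_s -> K),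
    [/\ forall i, max_ideal p (g i), forall i, max_ideal p (h i)
      & f = \sum_(i < s) g i * h i]].

(* dim_k (V / W) = d, for k-subspaces W of V of the function field *)
Definition has_quotient_dim (V W : set K) (d : nat) : Prop :=
  exists t : 'I_d -> K,
    [/\ forall i, V (t i),
        forall f, V f -> exists c : 'I_d -> k, W (f - \sum_(i < d) cst (c i) * t i)
      & forall c : 'I_d -> k, W (\sum_(i < d) cst (c i) * t i) -> forall i, c i = 0].

(* Nonsingular of dimension d: every local ring at a (closed) point is a regular
   local ring, i.e. dim m/m^2 is the dimension d of the ring. *)
Definition smooth_of_dim (d : nat) : Prop :=
  has_dim d /\
  forall p : point, has_quotient_dim (max_ideal p) (max_ideal_sq p) d.

Definition smooth_curve : Prop := smooth_of_dim 1.

Definition uniformizer (p : point) (t : K) : Prop :=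
  max_ideal p t /\
  forall f, max_ideal p f -> exists2 g, local_ring p g & f = t * g.

(* f is nonzero and ord_p(f) = m *)
Definition has_ord (p : point) (f : K) (m : int) : Prop :=
  exists t u : K, [/\ uniformizer p t, u != 0, local_ring p u, local_ring p u^-1
                    & f = u * t ^ m].

Definition divisor := {freeg point}.

Definition effective (E : divisor) : Prop := forall p, 0 <= coeff p E.

(* div f = E - D *)
Definition is_div_diff (f : K) (E D : divisor) : Prop :=
  forall p, has_ord p f (coeff p E - coeff p D).

Definition lin_system (D : divisor) : set divisor :=
  [set E | effective E /\ exists f : K, is_div_diff f E D].

Definition base_point_free (D : divisor) : Prop :=
  forall p : point, exists2 E, lin_system D E & coeff p E = 0.

Definition riemann_roch_space (D : divisor) : set K :=
  [set f | f = 0 \/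
    forall p : point, exists2 m : int, has_ord p f m & 0 <= m + coeff p D].

(* l(D) = l *)
Definition has_ell (D : divisor) (l : nat) : Prop :=
  has_quotient_dim (riemann_roch_space D) [set 0] l.

(* dim |D| = d; the projective space |D| is P(L(D)), of dimension -1 if empty *)
Definition lin_system_dim (D : divisor) (d : int) : Prop :=
  exists2 l : nat, has_ell D l & d = l%:Z - 1.

(* The genus is the least g such that l(D) >= deg D + 1 - g for all D. *)
Definition riemann_bound (g : nat) : Prop :=
  forall (D : divisor) (l : nat), has_ell D l -> deg D + 1 - g%:Z <= l%:Z.

Definition has_genus (g : nat) : Prop :=
  riemann_bound g /\ forall g', riemann_bound g' -> (g <= g')%N.

Definition mult_pt (m : nat) (P : point) : divisor := << m%:Z *g P >>.

Definition WS (P : point) : set nat :=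
  [set m | m = 0%N \/ base_point_free (mult_pt m P)].

Definition weierstrass_point (g : nat) (P : point) : Prop :=
  ~` WS P <> [set m | (1 <= m <= g)%N].

Definition first_nongap (P : point) (a : nat) : Prop :=
  [/\ (0 < a)%N, WS P a & forall m, (0 < m)%N -> WS P m -> (a <= m)%N].

Definition first_nongap_not_multiple (P : point) (a b : nat) : Prop :=
  [/\ WS P b, ~~ (a %| b)%N
    & forall m, WS P m -> ~~ (a %| m)%N -> (b <= m)%N].

End Variety.

Definition semigroup2 (a b : nat) : set nat :=
  [set m | exists i j : nat, m = (i * a + j * b)%N].

(* The set T of trivial new non-gaps for a cusp of type (mu; a); nm is n(m). *)
Definition trivial_nongaps (mu a b : nat) : set nat :=
  [set x | exists m nm i : nat,
    [/\ (1 <= m <= mu - 1)%N,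
        (nm%:Z - 1) * mu%:Z < m%:Z * a%:Z < nm%:Z * mu%:Z,
        (nm <= i <= a - 1)%N
      & x%:Z = i%:Z * b%:Z - m%:Z * a%:Z]].

(* Main.v *)
(**
  Normalize x so that div x = aQ - aP. A function with pole divisor bQ, times
  x^(n+1), lies in L((n+1)aP), which has dimension n + 3 and is therefore spanned
  by the powers of x and a function with pole divisor bP. So it can be corrected
  by a multiple of x^(n+1) into a function y regular outside P, with a pole of
  order b at P and a zero of order a - r at Q. The functions x^i y^j and y^i / x^m
  realize the semigroup generated by a and b and the trivial new non-gaps at P,
  and (1/x, y / x^(n+1)) plays the same role at Q. The complement of this set of
  non-gaps has at most g elements, whereas P and Q have at least g gaps.

  Riemann-Roch is not needed. The hypothesis on L((n+1)aP) makes every L(D)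
  finite-dimensional; Riemann's inequality then bounds the number of zeros of a
  function by the degree of its divisor of poles, and the minimality of g turns
  Riemann's inequality into an equality for L(mP) with m large.
*)
Require Import Defs.
From mathcomp Require Import all_boot all_order all_algebra.
From mathcomp Require Import boolp.
From mathcomp Require Import zify ring.

Set Implicit Arguments.
Unset Strict Implicit.
Unset Printing Implicit Defensive.

Import Order.TTheory GRing.Theory Num.Theory.
Local Open Scope classical_set_scope.
Local Open Scope ring_scope.

(** * Local rings *)

Section LocalRing.
Variables (k : closedFieldType) (X : projVariety k) (p : point X).

Local Notation K := (pv_field X).
Local Notation cst := (pv_const X).
Local Notation gen := (mmap (pv_const X) (@pv_gen k X)).
Local Notation ev := (pt_eval (val p)).
Local Notation O := (local_ring p).
Local Notation M := (max_ideal p).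

Lemma gen_eq0_pt d F : F \is d.-homog -> gen F = 0 -> ev F = 0.
Proof. by move=> hF /(pv_genP hF); apply. Qed.

Lemma gen_neq0 d F : F \is d.-homog -> ev F != 0 -> gen F != 0.
Proof. by move=> hF; apply: contra_neq; apply: gen_eq0_pt hF. Qed.

Lemma local_ringD f g : O f -> O g -> O (f + g).
Proof.
move=> [d [F [G [hF hG G0 ->]]]] [d' [F' [G' [hF' hG' G'0 ->]]]].
exists (d + d')%N, (F * G' + F' * G), (G * G').
have nG := gen_neq0 hG G0; have nG' := gen_neq0 hG' G'0.
split.
- by apply: rpredD; [|rewrite addnC]; apply: dhomogM.
- exact: dhomogM.
- by rewrite /pt_eval rmorphM mulf_neq0.
- by rewrite rmorphD !rmorphM addf_div.
Qed.

Lemma local_ringM f g : O f -> O g -> O (f * g).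
Proof.
move=> [d [F [G [hF hG G0 ->]]]] [d' [F' [G' [hF' hG' G'0 ->]]]].
exists (d + d')%N, (F * F'), (G * G').
split; try exact: dhomogM.
- by rewrite /pt_eval rmorphM mulf_neq0.
- by rewrite !rmorphM mulf_div.
Qed.

Lemma local_ringC c : O (cst c).
Proof.
exists 0%N, c%:MP, 1; split.
- by rewrite -[c%:MP]mulr1 mul_mpolyC rpredZ ?dhomog1.
- exact: dhomog1.
- by rewrite /pt_eval rmorph1 oner_neq0.
- by rewrite mmapC rmorph1 divr1.
Qed.

Lemma local_ring1 : O 1. Proof. by rewrite -(rmorph1 cst); apply: local_ringC. Qed.
Lemma local_ring0 : O 0. Proof. by rewrite -(rmorph0 cst); apply: local_ringC. Qed.

Lemma local_ringX f n : O f -> O (f ^+ n).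
Proof.
move=> Of; elim: n => [|n IHn]; first by rewrite expr0; apply: local_ring1.
by rewrite exprS; apply: local_ringM.
Qed.

Lemma max_ideal_local_ring f : M f -> O f.
Proof. by move=> [d [F [G [hF hG _ G0 ->]]]]; exists d, F, G. Qed.

Lemma max_idealMr f g : M f -> O g -> M (f * g).
Proof.
move=> [d [F [G [hF hG F0 G0 ->]]]] [d' [F' [G' [hF' hG' G'0 ->]]]].
exists (d + d')%N, (F * F'), (G * G').
split; try exact: dhomogM.
- by rewrite /pt_eval rmorphM /= [X in X * _]F0 mul0r.
- by rewrite /pt_eval rmorphM mulf_neq0.
- by rewrite !rmorphM mulf_div.
Qed.

Lemma max_idealD f g : M f -> M g -> M (f + g).
Proof.
move=> [d [F [G [hF hG F0 G0 ->]]]] [d' [F' [G' [hF' hG' F'0 G'0 ->]]]].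
exists (d + d')%N, (F * G' + F' * G), (G * G').
have nG := gen_neq0 hG G0; have nG' := gen_neq0 hG' G'0.
split.
- by apply: rpredD; [|rewrite addnC]; apply: dhomogM.
- exact: dhomogM.
- by rewrite /pt_eval rmorphD !rmorphM /= [X in X * _]F0 [X in _ + X * _]F'0 !mul0r addr0.
- by rewrite /pt_eval rmorphM mulf_neq0.
- by rewrite rmorphD !rmorphM addf_div.
Qed.

Lemma max_ideal0 : M 0.
Proof.
exists 0%N, 0, 1; split.
- exact: rpred0.
- exact: dhomog1.
- by rewrite /pt_eval rmorph0.
- by rewrite /pt_eval rmorph1 oner_neq0.
- by rewrite rmorph0 mul0r.
Qed.

(** With [f] and its inverse written as F/G and F'/G', the form FF' - GG' vanishes at the generic
    point, hence at [p]; but there F vanishes while G and G' do not. *)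
Lemma max_ideal_nonunit f : f != 0 -> M f -> O f^-1 -> False.
Proof.
move=> f0 [d [F [G [hF hG F0 G0 fE]]]] [d' [F' [G' [hF' hG' G'0 fE']]]].
have nG := gen_neq0 hG G0; have nG' := gen_neq0 hG' G'0.
have e : gen (F * F' - G * G') = 0.
  have /eqP := mulfV f0; rewrite fE' fE mulf_div.
  rewrite -(divr1 1) eqr_div ?mulf_neq0 ?oner_neq0 // mulr1 mul1r => /eqP e.
  by rewrite rmorphB !rmorphM /= e subrr.
have h : F * F' - G * G' \is (d + d').-homog by apply: rpredB; apply: dhomogM.
have /eqP := gen_eq0_pt h e.
rewrite /pt_eval rmorphB !rmorphM /= [X in X * _]F0 mul0r sub0r oppr_eq0.
by rewrite mulf_eq0 (negbTE G0) (negbTE G'0).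
Qed.

Lemma local_ring_residue f : O f -> exists c, M (f - cst c).
Proof.
move=> [d [F [G [hF hG G0 ->]]]]; have nG := gen_neq0 hG G0.
exists (ev F / ev G), d, (F - (ev F / ev G) *: G), G; split=> //.
- by rewrite rpredB // rpredZ.
- rewrite /pt_eval rmorphB /= mevalZ -/(pt_eval (val p) G) -/(pt_eval (val p) F).
  by rewrite divfK // subrr.
- by rewrite rmorphB /= mmapZ mulrBl mulfK.
Qed.

Lemma local_ring_unit f : O f -> ~ M f -> O f^-1.
Proof.
move=> [d [F [G [hF hG G0 ->]]]] Mf; exists d, G, F; split=> //.
  by apply/eqP => F0; apply: Mf; exists d, F, G.
by rewrite invf_div.
Qed.

(** Numerator and denominator are both divided by the [d]-th power of a coordinate that does not
    vanish at [p]. *)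
Lemma local_ring_frac f : exists g h, [/\ O g, O h, h != 0 & f = g / h].
Proof.
have [d [F [G [hF hG G0 ->]]]] := pv_fracP f.
have [i vi] : exists i, vpick (val (val p)) ord0 i != 0.
  apply/existsP; rewrite -negb_forall; apply/negP => /forallP v0.
  have /eqP : vpick (val (val p)) = 0.
    by apply/rowP => i; rewrite mxE; apply/eqP.
  by rewrite vpick0 -dimv_eq0 (eqP (valP (val p))).
have hX : ('X_i : {mpoly k[(pv_amb X).+1]}) ^+ d \is d.-homog.
  have {2}-> : d = (1 * d)%N by rewrite mul1n.
  by apply: dhomogMn; rewrite dhomogX /= mdeg1.
have X0 : ev ('X_i ^+ d) != 0 by rewrite /pt_eval rmorphXn /= mevalXU expf_neq0.
have nX := gen_neq0 hX X0.
exists (gen F / gen ('X_i ^+ d)), (gen G / gen ('X_i ^+ d)); split.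
- by exists d, F, ('X_i ^+ d).
- by exists d, G, ('X_i ^+ d).
- by rewrite mulf_neq0 ?invr_eq0.
- by rewrite invf_div mulrA divfK.
Qed.

End LocalRing.

(** * Dimension of spaces of functions *)

Section LinearAlgebra.
Variables (k : closedFieldType) (X : projVariety k).

Local Notation K := (pv_field X).
Local Notation cst := (pv_const X).

Implicit Types (V W : set K) (f g h : K).

Definition indep n (t : 'I_n -> K) :=
  forall c : 'I_n -> k, \sum_(i < n) cst (c i) * t i = 0 -> forall i, c i = 0.

(** A lower bound on the dimension that makes sense before [V] is known to be finite-dimensional;
    its negation serves as an upper bound. *)
Definition dimge V n := exists2 t : 'I_n -> K, forall i, V (t i) & indep t.

Definition subspace V :=
  [/\ V 0, forall f g, V f -> V g -> V (f + g) & forall c f, V f -> V (cst c * f)].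

Definition fcons n f (t : 'I_n -> K) (i : 'I_n.+1) : K := oapp t f (unlift ord0 i).

Lemma fcons0 n f (t : 'I_n -> K) : fcons f t ord0 = f.
Proof. by rewrite /fcons unlift_none. Qed.

Lemma fconsS n f (t : 'I_n -> K) i : fcons f t (lift ord0 i) = t i.
Proof. by rewrite /fcons liftK. Qed.

Lemma dimge_le V W n : (forall f, V f -> W f) -> dimge V n -> dimge W n.
Proof. by move=> VW [t Vt It]; exists t => // i; apply: VW. Qed.

Lemma dimge0 V : dimge V 0.
Proof. by exists (fun=> 0) => [[]|c _ []]. Qed.

Lemma dimgeW V m n : (m <= n)%N -> dimge V n -> dimge V m.
Proof.
move=> /subnK <-; elim: (n - m)%N => // d IHd [t Vt It].
apply: IHd; exists (fun i => t (lift ord0 i)) => // c hc i.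
pose c' (j : 'I_(d + m).+1) := oapp c 0 (unlift ord0 j).
have <- : c' (lift ord0 i) = c i by rewrite /c' liftK.
apply: It; rewrite big_ord_recl /c' unlift_none /= rmorph0 mul0r add0r.
by under eq_bigr do rewrite liftK /=.
Qed.

Lemma dimge_mul V W f n : f != 0 -> (forall h, V h -> W (f * h)) ->
  dimge V n -> dimge W n.
Proof.
move=> f0 VW [t Vt It]; exists (fun i => f * t i) => [i|c hc]; first exact: VW.
apply: It; apply: (mulfI f0); rewrite mulr0 -[RHS]hc.
by rewrite mulr_sumr; apply: eq_bigr => i _; rewrite mulrCA.
Qed.

(** Modulo [V], any element of [W] outside [V] spans [W]. One such member of the family is dropped
    after the others are corrected by multiples of it. *)
Lemma dimge_codim1 V W n :
  (forall f g, W f -> W g -> ~ V g -> exists c, V (f - cst c * g)) ->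
  dimge W n.+1 -> dimge V n.
Proof.
move=> VW Wn; have [t Wt It] := Wn.
have [Vt|/existsNP[j nVj]] := pselect (forall i, V (t i)).
  by apply: (@dimgeW _ _ n.+1) => //; exists t.
have /choice[c Vc] : forall i, exists c, V (t (lift j i) - cst c * t j).
  by move=> i; apply: VW.
exists (fun i => t (lift j i) - cst (c i) * t j) => // d hd i.
pose d' m := oapp d (- \sum_i d i * c i) (unlift j m).
have d'E m : d' (lift j m) = d m by rewrite /d' liftK.
rewrite -d'E; apply: It; rewrite (bigD1_ord j) //= {1}/d' unlift_none /=.
rewrite (eq_bigr (fun m => cst (d m) * t (lift j m))) => [|m _]; last by rewrite d'E.
rewrite -[RHS]hd; under [RHS]eq_bigr do rewrite mulrBr mulrA -rmorphM.
by rewrite sumrB -mulr_suml -rmorph_sum rmorphN mulNr addrC.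
Qed.

Lemma quotient_dim_dimge V l : has_quotient_dim V [set 0] l -> dimge V l.
Proof. by move=> [t [Vt _ It]]; exists t. Qed.

Lemma quotient_dim_max V l n : has_quotient_dim V [set 0] l -> dimge V n -> (n <= l)%N.
Proof.
move=> [t [Vt St _]] [s Vs Is].
have /choice[a sE] : forall i, exists c, s i = \sum_(j < l) cst (c j) * t j.
  by move=> i; have [c /eqP] := St _ (Vs i); rewrite subr_eq0 => /eqP; exists c.
pose A : 'M[k]_(n, l) := \matrix_(i, j) a i j.
rewrite leqNgt; apply/negP => ln.
have : kermx A != 0.
  by rewrite kermx_eq0 /row_free neq_ltn (leq_ltn_trans (rank_leq_col A) ln).
move=> /rowV0Pn[u /sub_kermxP uA u0]; case/negP: u0; apply/eqP/rowP => i.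
rewrite [RHS]mxE; apply: (Is (fun i => u ord0 i)).
under eq_bigr do rewrite sE mulr_sumr.
rewrite exchange_big big1 // => j _.
under eq_bigr do rewrite mulrA -rmorphM.
rewrite -mulr_suml -rmorph_sum.
have /rowP/(_ j) := uA; rewrite !mxE; under eq_bigr do rewrite mxE.
by move=> ->; rewrite rmorph0 mul0r.
Qed.

Lemma dimge_quotient_dim V l : subspace V -> dimge V l -> ~ dimge V l.+1 ->
  has_quotient_dim V [set 0] l.
Proof.
move=> [V0 VD VZ] [t Vt It] nV; exists t; split=> // f Vf.
have : ~ indep (fcons f t).
  move=> If; apply: nV; exists (fcons f t) => // i.
  by case: (unliftP ord0 i) => [j|] ->; rewrite ?fconsS ?fcons0.
move=> /existsNP[c /not_implyP[hc /existsNP[i /eqP ci]]].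
move: hc; rewrite big_ord_recl fcons0; under eq_bigr do rewrite fconsS.
have [c0|c0] := eqVneq (c ord0) 0.
  rewrite c0 rmorph0 mul0r add0r => /It ct; case/eqP: ci.
  by case: (unliftP ord0 i) => [j|] ->.
move=> hc; exists (fun j => - (c ord0)^-1 * c (lift ord0 j)) => /=.
have c0' : cst (c ord0) != 0 by rewrite fmorph_eq0.
under eq_bigr do rewrite rmorphM -mulrA.
rewrite -mulr_sumr rmorphN fmorphV mulNr opprK.
by apply: (mulfI c0'); rewrite mulr0 mulrDr mulVKf.
Qed.

End LinearAlgebra.

(** * Orders of vanishing on a smooth curve *)

Section Valuation.
Variables (k : closedFieldType) (X : projVariety k).

Local Notation K := (pv_field X).
Local Notation cst := (pv_const X).

Hypothesis alg_dep2 : forall v : 'I_2 -> K, ~ alg_indep v.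
Hypothesis ex_uniformizer : forall p : point X, exists2 t, uniformizer p t & t != 0.

Implicit Types (p : point X) (f g h t u : K).

(* Divide an algebraic relation between h and t by its lexicographically least
   monomial: if a high power of t divided h, the coefficient of that monomial
   would lie in the maximal ideal. *)
Lemma not_infinitely_divisible p h t : max_ideal p t -> t != 0 -> h != 0 ->
  exists N : nat, forall w, local_ring p w -> h <> t ^+ N * w.
Proof.
move=> Mt t0 h0; pose v (i : 'I_2) := if i == ord0 then h else t.
have [F F0 nF] : exists2 F, mmap cst v F = 0 & F != 0.
  apply: contrapT => hF; apply: (@alg_dep2 v) => F eF; apply: contrapT => nF.
  by apply: hF; exists F => //; apply/eqP.
have mE (m : 'X_{1..2}) : mmap1 v m = h ^+ m ord0 * t ^+ m ord_max.
  by rewrite /mmap1 big_ord_recl big_ord1 /v /=; congr (_ * t ^+ m _); apply: val_inj.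
have Pi : exists i, has (fun m : 'X_{1..2} => m ord0 == i) (msupp F).
  exists (mlead F ord0); apply/hasP; exists (mlead F) => //.
  exact: mlead_supp.
case: (ex_minnP Pi) => i0 /hasP[m1 m1F /eqP m1i] i0min.
have Pj : exists j, has (fun m : 'X_{1..2} => (m ord0 == i0) && (m ord_max == j)) (msupp F).
  by exists (m1 ord_max); apply/hasP; exists m1 => //; rewrite m1i !eqxx.
case: (ex_minnP Pj) => j0 /hasP[m0 m0F /andP[/eqP m0i /eqP m0j]] j0min.
(* One more than [j0], so that [h / t ^+ j0] still has a factor [t]. *)
exists j0.+1 => w Ow hE.
have Oh : local_ring p h.
  rewrite hE; apply: local_ringM => //; apply: local_ringX.
  exact: max_ideal_local_ring.
have Ot := max_ideal_local_ring Mt.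
have nd : h ^+ i0 * t ^+ j0 != 0 by rewrite mulf_neq0 ?expf_neq0.
have hj : max_ideal p (h / t ^+ j0).
  rewrite hE exprS (_ : _ / _ = t * w); first exact: max_idealMr.
  by field; rewrite expf_neq0.
(* After division by [h ^+ i0 * t ^+ j0], every other term of the relation has a factor
   [h / t ^+ j0] or [t], both in the maximal ideal. *)
have Mc : max_ideal p (cst F@_m0).
  suff: max_ideal p (- cst F@_m0).
    move=> /max_idealMr /(_ (local_ringC p (-1))).
    by rewrite rmorphN1 mulrN1 opprK.
  move/eqP: F0; rewrite /mmap (bigD1_seq m0) ?msupp_uniq //= addrC addr_eq0.
  move=> /eqP /(congr1 (fun x => x / (h ^+ i0 * t ^+ j0))).
  rewrite mulNr mE m0i m0j mulfK // => <-; rewrite mulr_suml big_seq_cond.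
  apply: big_ind; [exact: max_ideal0 | exact: max_idealD | ].
  move=> m /andP[mF mm0]; rewrite mE -mulrA mulrC; apply: max_idealMr (local_ringC _ _).
  have mi : (i0 <= m ord0)%N by apply: i0min; apply/hasP; exists m.
  have [mi0|mi0] := ltnP i0 (m ord0).
    rewrite -(subnKC mi0) addSnnS exprD exprS.
    have -> : h ^+ i0 * (h * h ^+ (m ord0 - i0.+1)) * t ^+ m ord_max / (h ^+ i0 * t ^+ j0)
      = h / t ^+ j0 * (h ^+ (m ord0 - i0.+1) * t ^+ m ord_max).
      by field; rewrite !expf_neq0.
    by apply: max_idealMr => //; apply: local_ringM; apply: local_ringX.
  have mie : m ord0 = i0 by apply/eqP; rewrite eqn_leq mi mi0.
  have mj : (j0 <= m ord_max)%N by apply: j0min; apply/hasP; exists m => //; rewrite mie !eqxx.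
  have mj0 : (j0 < m ord_max)%N.
    rewrite ltn_neqAle mj andbT; apply: contra_neq mm0 => e.
    apply/mnmP => i; case: (unliftP ord0 i) => [j|] ->; last by rewrite mie.
    by rewrite (ord1 j) (_ : lift _ _ = ord_max) -?e //; apply: val_inj.
  rewrite -(subnKC mj0) addSnnS exprD exprS mie.
  have -> : h ^+ i0 * (t ^+ j0 * (t * t ^+ (m ord_max - j0.+1))) / (h ^+ i0 * t ^+ j0)
      = t * t ^+ (m ord_max - j0.+1).
    by field; rewrite !expf_neq0.
  by apply: max_idealMr => //; apply: local_ringX.
have c0 : cst F@_m0 != 0 by rewrite fmorph_eq0 mcoeff_eq0 negbK.
by apply: max_ideal_nonunit c0 Mc _; rewrite -fmorphV; apply: local_ringC.
Qed.

(** * Local units and the order of a function *)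

Definition local_unit p u := [/\ u != 0, local_ring p u & local_ring p u^-1].

Lemma local_unitM p u w : local_unit p u -> local_unit p w -> local_unit p (u * w).
Proof.
move=> [u0 Ou Ou'] [w0 Ow Ow']; split; first exact: mulf_neq0.
  exact: local_ringM.
by rewrite invfM; apply: local_ringM.
Qed.

Lemma local_unitV p u : local_unit p u -> local_unit p u^-1.
Proof. by move=> [u0 Ou Ou']; split; rewrite ?invr_eq0 ?invrK. Qed.

Lemma local_unitXz p u m : local_unit p u -> local_unit p (u ^ m).
Proof.
move=> Uu; have UX n : local_unit p (u ^+ n).
  elim: n => [|n IHn]; last by rewrite exprS; apply: local_unitM.
  by split; rewrite ?expr0 ?invr1 ?oner_neq0 //; apply: local_ring1.
by case: m => n; [|apply: local_unitV]; apply: UX.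
Qed.

Lemma local_unitC p c : c != 0 -> local_unit p (cst c).
Proof.
by move=> c0; split; rewrite ?fmorph_eq0 -?fmorphV //; apply: local_ringC.
Qed.

Lemma has_ordE p f m : has_ord p f m <->
  exists2 t, uniformizer p t & exists2 u, local_unit p u & f = u * t ^ m.
Proof.
split=> [[t [u [Ut u0 Ou Ou' ->]]]|[t Ut [u [u0 Ou Ou'] ->]]].
  by exists t => //; exists u.
by exists t, u.
Qed.

Lemma uniformizer_neq0 p t : uniformizer p t -> t != 0.
Proof.
move=> [_ Ut]; have [s [Ms _] s0] := ex_uniformizer p.
by have [g _ e] := Ut _ Ms; apply: contra_neq s0 => t0; rewrite e t0 mul0r.
Qed.

Lemma uniformizer_eq p s t : uniformizer p s -> uniformizer p t ->
  exists2 u, local_unit p u & s = u * t.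
Proof.
move=> Us Ut; have s0 := uniformizer_neq0 Us.
have [g Og e] := Ut.2 _ Us.1; have [h Oh e'] := Us.2 _ Ut.1.
have g0 : g != 0 by apply: contra_neq s0 => g0; rewrite e g0 mulr0.
exists g; last by rewrite mulrC.
split=> //; suff -> : g^-1 = h by [].
apply: (mulIf g0); rewrite mulVf //; apply: (mulfI s0).
by rewrite mulr1 mulrA -e' -e.
Qed.

Lemma has_ord_unif p t f m : uniformizer p t -> has_ord p f m ->
  exists2 u, local_unit p u & f = u * t ^ m.
Proof.
move=> Ut /has_ordE[s Us [u Uu ->]].
have [w Uw ->] := uniformizer_eq Us Ut.
exists (u * w ^ m); first by apply: local_unitM => //; apply: local_unitXz.
by rewrite expfzMl mulrA.
Qed.

(** If [n] exceeded [m], comparing the two expressions of [f] would make the inverse of a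
    uniformizer regular at [p]. *)
Lemma has_ord_le p f m n : has_ord p f m -> has_ord p f n -> (n <= m).
Proof.
have [t Ut t0] := ex_uniformizer p.
move=> /(has_ord_unif Ut)[u Uu ->] /(has_ord_unif Ut)[w Uw e].
rewrite leNgt; apply/negP => mn.
have [d dE] : exists d : nat, n = m + d.+1%:Z.
  by exists (`|n - m|.-1)%N; lia.
move: e; rewrite dE expfzDr // -exprnP exprS.
have [u0 Ou Ou'] := Uu; have [w0 Ow Ow'] := Uw.
rewrite [RHS]mulrCA [LHS]mulrC => /(mulfI (expfz_neq0 _ t0)) e.
apply: (max_ideal_nonunit t0 Ut.1).
have -> : t^-1 = w * t ^+ d * u^-1.
  by apply: (mulfI t0); rewrite mulfV // -(mulfV u0) {1}e; ring.
do !apply: local_ringM => //; apply: local_ringX.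
exact: max_ideal_local_ring Ut.1.
Qed.

Lemma has_ord_inj p f m n : has_ord p f m -> has_ord p f n -> m = n.
Proof.
by move=> hm hn; apply: le_anti; rewrite (has_ord_le hm hn) (has_ord_le hn hm).
Qed.

(** Take the largest [n] such that [t ^+ n] divides [h]: the cofactor is not divisible by [t], so it
    lies outside the maximal ideal. *)
Lemma local_ring_has_ord p t h : uniformizer p t -> local_ring p h -> h != 0 ->
  exists n : nat, exists2 u, local_unit p u & h = u * t ^+ n.
Proof.
move=> Ut Oh h0; have t0 := uniformizer_neq0 Ut.
have [N hN] := not_infinitely_divisible Ut.1 t0 h0.
have P : exists n, `[< forall w, local_ring p w -> h <> t ^+ n * w >].
  by exists N; apply/asboolP.
case: (ex_minnP P) => -[|n] /asboolP hn nmin.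
  by case: (hn h Oh); rewrite expr0 mul1r.
have : ~~ `[< forall w, local_ring p w -> h <> t ^+ n * w >].
  by apply/negP => /nmin; rewrite ltnn.
move=> /asboolPn /existsNP[w /not_implyP[Ow /contrapT hE]].
exists n, w; last by rewrite mulrC.
split=> //; first by apply: contra_neq h0 => w0; rewrite hE w0 mulr0.
apply: local_ring_unit => // Mw; have [g Og wE] := Ut.2 _ Mw.
by apply: (hn g Og); rewrite hE wE exprSr mulrA.
Qed.

Lemma has_ord_exists p f : f != 0 -> exists m, has_ord p f m.
Proof.
move=> f0; have [t Ut t0] := ex_uniformizer p.
have [g [h [Og Oh h0 fE]]] := local_ring_frac p f.
have g0 : g != 0 by apply: contra_neq f0 => g0; rewrite fE g0 mul0r.
have [n [u Uu gE]] := local_ring_has_ord Ut Og g0.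
have [n' [u' Uu' hE]] := local_ring_has_ord Ut Oh h0.
exists (n%:Z - n'%:Z); apply/has_ordE; exists t => //.
exists (u / u'); first by apply: local_unitM => //; apply: local_unitV.
by rewrite fE gE hE expfzDr // -exprnN -exprnP mulf_div.
Qed.

(** The zero function gets the default order 0; [vge] below treats its order as infinite. *)
Definition ord p f : int := xget 0 [set m | has_ord p f m].

Lemma ordP p f : f != 0 -> has_ord p f (ord p f).
Proof. by move=> /(has_ord_exists p); apply: xgetPex. Qed.

Lemma has_ord_neq0 p f m : has_ord p f m -> f != 0.
Proof.
move=> /has_ordE[t Ut [u [u0 _ _] ->]].
by rewrite mulf_neq0 // expfz_neq0 // (uniformizer_neq0 Ut).
Qed.

Lemma has_ord_ord p f m : has_ord p f m -> ord p f = m.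
Proof.
by move=> hm; apply: has_ord_inj (hm); apply/ordP/(has_ord_neq0 hm).
Qed.

Lemma ordM p f g : f != 0 -> g != 0 -> ord p (f * g) = ord p f + ord p g.
Proof.
move=> f0 g0; have [t Ut t0] := ex_uniformizer p.
have [u Uu {1}->] := has_ord_unif Ut (ordP p f0).
have [w Uw {1}->] := has_ord_unif Ut (ordP p g0).
apply: has_ord_ord; apply/has_ordE; exists t => //; exists (u * w).
  exact: local_unitM.
by rewrite expfzDr // mulrACA.
Qed.

Lemma ordC p c : c != 0 -> ord p (cst c) = 0.
Proof.
move=> c0; have [t Ut t0] := ex_uniformizer p.
apply: has_ord_ord; apply/has_ordE; exists t => //; exists (cst c).
  exact: local_unitC.
by rewrite expr0z mulr1.
Qed.

Lemma ord_one p : ord p 1 = 0.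
Proof. by rewrite -(rmorph1 cst) ordC ?oner_neq0. Qed.

Lemma ordV p f : f != 0 -> ord p f^-1 = - ord p f.
Proof.
move=> f0; have := ordM p (invr_neq0 f0) f0.
by rewrite mulVf // ord_one => /esym/eqP; rewrite addr_eq0 => /eqP.
Qed.

Lemma ordX p f n : f != 0 -> ord p (f ^+ n) = ord p f *+ n.
Proof.
move=> f0; elim: n => [|n IHn]; first by rewrite expr0 ord_one.
by rewrite exprS ordM ?expf_neq0 // IHn mulrS.
Qed.

Definition vge p m f := f = 0 \/ m <= ord p f.

(** Twisting by [t ^ (- m)] reduces order bounds to membership in the local ring, whose closure
    under sums and products then carries over. *)
Lemma vgeP p t m f : uniformizer p t -> vge p m f <-> local_ring p (f * t ^ (- m)).
Proof.
move=> Ut; have t0 := uniformizer_neq0 Ut; split=> [[->|]|].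
- by rewrite mul0r; apply: local_ring0.
- have [->|f0] := eqVneq f 0; first by rewrite mul0r => _; apply: local_ring0.
  have [u [_ Ou _] {2}->] := has_ord_unif Ut (ordP p f0); move=> mf.
  rewrite -mulrA -expfzDr //.
  have -> : ord p f - m = `|ord p f - m|%N by lia.
  apply: local_ringM => //; apply: local_ringX.
  exact: max_ideal_local_ring Ut.1.
have [->|f0] := eqVneq f 0; first by left.
have tm0 : t ^ (- m) != 0 by rewrite expfz_neq0.
move=> Of; have [n [u Uu e]] := local_ring_has_ord Ut Of (mulf_neq0 f0 tm0).
right; suff -> : ord p f = m + n%:Z by lia.
apply: has_ord_ord; apply/has_ordE; exists t => //; exists u => //.
apply: (mulIf tm0); rewrite e -mulrA -expfzDr //.
by rewrite (_ : m + n%:Z - m = n%:Z) //; lia.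
Qed.

Lemma vge0 p m : vge p m 0. Proof. by left. Qed.

Lemma vgeD p m f g : vge p m f -> vge p m g -> vge p m (f + g).
Proof.
have [t Ut _] := ex_uniformizer p.
rewrite !(vgeP _ _ Ut) mulrDl; exact: local_ringD.
Qed.

Lemma vgeM p m n f g : vge p m f -> vge p n g -> vge p (m + n) (f * g).
Proof.
have [t Ut _] := ex_uniformizer p; have t0 := uniformizer_neq0 Ut.
rewrite !(vgeP _ _ Ut) opprD expfzDr // mulrACA; exact: local_ringM.
Qed.

Lemma vgeC p c : vge p 0 (cst c).
Proof.
have [->|c0] := eqVneq c 0; first by rewrite rmorph0; left.
by right; rewrite ordC.
Qed.

Lemma vgeZ p m c f : vge p m f -> vge p m (cst c * f).
Proof. by rewrite -{2}(add0r m); apply: vgeM; apply: vgeC. Qed.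

Lemma vgeW p m n f : m <= n -> vge p n f -> vge p m f.
Proof. by move=> mn [->|h]; [left|right; apply: le_trans h]. Qed.

Lemma vge_ord p f : vge p (ord p f) f. Proof. by right. Qed.

Lemma vgeN p m f : vge p m f -> vge p m (- f).
Proof. by move=> /(vgeZ (-1)); rewrite rmorphN1 mulN1r. Qed.

Lemma vge_sum p m (I : Type) (r : seq I) (P : pred I) (F : I -> K) :
  (forall i, P i -> vge p m (F i)) -> vge p m (\sum_(i <- r | P i) F i).
Proof. by move=> h; apply: big_ind => //; [exact: vge0 | exact: vgeD]. Qed.

Lemma ordDl p f g : f != 0 -> vge p (ord p f + 1) g ->
  f + g != 0 /\ ord p (f + g) = ord p f.
Proof.
move=> f0 hg; have fg : vge p (ord p f) (f + g).
  by apply: vgeD (vge_ord p f) (vgeW _ hg); lia.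
have nge : ~ vge p (ord p f + 1) (f + g).
  move=> /vgeD /(_ (vgeN hg)); rewrite addrK => -[/eqP|]; last lia.
  by rewrite (negbTE f0).
split; first by apply/eqP => e; apply: nge; left.
case: fg => [e|]; first by case: nge; left.
move=> h; apply/eqP; rewrite eq_le h andbT leNgt; apply/negP => h'.
by apply: nge; right; lia.
Qed.

(** The constant [c] is the value of [f / g] at [p]. *)
Lemma vge_residue p f g : g != 0 -> vge p (ord p g) f ->
  exists c, vge p (ord p g + 1) (f - cst c * g).
Proof.
move=> g0 hf; have [t Ut t0] := ex_uniformizer p.
have := vgeM hf (vge_ord p g^-1); rewrite ordV // subrr (vgeP _ _ Ut) oppr0 expr0z mulr1.
move=> /local_ring_residue[c /(Ut.2)[w Ow e]]; exists c.
have -> : f - cst c * g = g * (t * w) by rewrite -e mulrBr mulrCA mulfV // mulr1 mulrC.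
apply: vgeM (vge_ord p g) _; apply/(vgeP _ _ Ut).
by rewrite mulrAC mulfV // mul1r.
Qed.

(** * Riemann-Roch spaces *)

(** In a combination, the term of least order among those with nonzero coefficient cannot be
    cancelled by the others. *)
Lemma indep_ord p n (t : 'I_n -> K) : (forall i, t i != 0) ->
  injective (fun i => ord p (t i)) -> indep t.
Proof.
move=> t0 inj c hc i; apply: contrapT => /eqP ci.
case: (@arg_minP _ _ _ i (fun i => c i != 0) (fun i => ord p (t i)) ci) => j cj jmin.
move: hc; rewrite (bigD1 j) //=; apply/eqP.
have cj0 : cst (c j) != 0 by rewrite fmorph_eq0.
apply: (ordDl (mulf_neq0 cj0 (t0 j)) _).1.
rewrite ordM // ordC // add0r; apply: vge_sum => l lj.
have [->|cl] := eqVneq (c l) 0; first by rewrite rmorph0 mul0r; apply: vge0.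
apply/vgeZ/vgeW/vge_ord; rewrite lezD1 lt_neqAle; apply/andP; split; last exact: jmin.
by apply: contra_neq lj => /inj.
Qed.

Implicit Types (D A : divisor X) (s : seq (point X)).

Local Notation L := (@riemann_roch_space k X).

Lemma RR_vge D f : L D f <-> forall p, vge p (- coeff p D) f.
Proof.
split=> [[->|hf] p|hf]; first exact: vge0.
  by have [m /has_ord_ord <- h] := hf p; right; lia.
have [->|f0] := eqVneq f 0; first by left.
right=> p; exists (ord p f); first exact: ordP.
case: (hf p) => [e|]; first by rewrite e eqxx in f0.
by move=> h; lia.
Qed.

Lemma RR_subspace D : subspace (L D).
Proof.
split=> [|f g|c f]; rewrite ?RR_vge.
- by move=> p; apply: vge0.
- by move=> hf hg p; apply: vgeD.
- by move=> hf p; apply: vgeZ.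
Qed.

Lemma RR_mul D E f g : L D f -> L E g -> L (D + E) (f * g).
Proof.
rewrite !RR_vge => hf hg p; rewrite coeffD opprD; exact: vgeM.
Qed.

Lemma RR_le D E f : (forall p, coeff p D <= coeff p E) -> L D f -> L E f.
Proof. by rewrite !RR_vge => DE hf p; apply: vgeW (hf p); rewrite lerN2. Qed.

(** Effective divisors are handled as lists of points with repetition, which allows induction one
    point at a time. *)
Definition pts s : divisor X := \sum_(p <- s) << p >>.

Lemma coeff_pts p s : coeff p (pts s) = (count_mem p s)%:Z.
Proof.
rewrite /pts raddf_sum /=; elim: s => [|q s IHs]; first by rewrite big_nil.
by rewrite big_cons IHs coeffU mul1r /= PoszD natz.
Qed.

Lemma deg_pts s : deg (pts s) = (size s)%:Z.
Proof.
rewrite /pts raddf_sum /=; elim: s => [|q s IHs]; first by rewrite big_nil.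
by rewrite big_cons IHs degU -intS.
Qed.

(** Adding one point [p] to a divisor raises the dimension by at most one: two functions of the
    larger space are compared by their leading coefficients at [p]. *)
Lemma dimge_RR_pts D s n : dimge (L (D + pts s)) (n + size s) -> dimge (L D) n.
Proof.
elim: s D n => [|p s IHs] D n; first by rewrite /pts big_nil addr0 addn0.
rewrite /pts big_cons -/(pts s) addrA addrAC /= addnS.
move=> /(@dimge_codim1 _ _ (L (D + pts s))) h; apply/IHs/h => f g {h IHs}.
move: (D + pts s) => {}D; rewrite !RR_vge => hf hg /existsNP[q nq].
have cE q' : coeff q' (D + << p >>) = coeff q' D + (p == q')%:R.
  by rewrite coeffD coeffU mul1r.
have qp : q = p.
  apply: contrapT => /eqP qp; apply: nq; have := hg q.
  by rewrite cE eq_sym (negbTE qp) addr0.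
subst q; have g0 : g != 0 by apply: contra_notN nq => /eqP ->; apply: vge0.
have og : ord p g = - coeff p (D + << p >>).
  case: (hg p) => [e|]; first by rewrite e eqxx in g0.
  have : ~ (- coeff p D <= ord p g) by move=> h; apply: nq; right.
  by rewrite cE eqxx /=; lia.
have [c hc] : exists c, vge p (ord p g + 1) (f - cst c * g).
  by apply: vge_residue => //; rewrite og.
exists c; apply/RR_vge => q; have [->|qp] := eqVneq q p.
  by apply: vgeW hc; rewrite og cE eqxx /=; lia.
have := hf q; have := hg q; rewrite cE eq_sym (negbTE qp) addr0 => hgq hfq.
by apply: vgeD hfq (vgeN _); apply: vgeZ.
Qed.

Lemma divisor_le_pts D : exists s, forall p, coeff p D <= coeff p (pts s).
Proof.
exists (flatten [seq nseq `|coeff p D|%N p | p <- dom D]) => p; rewrite coeff_pts.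
have [pD|/coeff_outdom ->] := boolP (p \in dom D); last by [].
have : (`|coeff p D| <= count_mem p (flatten [seq nseq `|coeff q D|%N q | q <- dom D]))%N.
  elim: (dom D) pD => // q r IHr; rewrite inE /= count_cat count_nseq /=.
  case: eqVneq => [-> _|_ /= /IHr]; first by rewrite ?eqxx mul1n leq_addr.
  by move=> /leq_trans; apply; apply: leq_addl.
by rewrite -lez_nat abszE; apply: le_trans; apply: ler_norm.
Qed.

(** * Finite dimension, Riemann's inequality and zeros of functions *)

Section FiniteDim.
Variables (D0 : divisor X) (l0 : nat).
Hypothesis fin0 : ~ dimge (L D0) l0.

(** [D] is bounded by [D0] plus finitely many points, each of which raises the dimension by at most
    one. *)
Lemma RR_finite D : exists l, ~ dimge (L D) l.
Proof.
have [s hs] := divisor_le_pts (D - D0).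
exists (l0 + size s)%N => h; apply: fin0; apply: (@dimge_RR_pts _ s).
apply: dimge_le h => f; apply: RR_le => p.
by rewrite coeffD -lerBlDl -coeffB.
Qed.

Lemma ex_ell D : exists l, has_ell D l.
Proof.
have P : exists l, ~~ `[< dimge (L D) l >].
  by have [l hl] := RR_finite D; exists l; apply/asboolPn.
case: (ex_minnP P) => -[|l] /asboolPn hl lmin.
  by case: hl; apply: dimge0.
exists l; apply: dimge_quotient_dim (RR_subspace D) _ hl.
by apply: contrapT => /asboolPn /lmin; rewrite ltnn.
Qed.

Variable g : nat.
Hypothesis bound : riemann_bound X g.

Lemma riemann_dimge D n : n%:Z <= deg D + 1 - g%:Z -> dimge (L D) n.
Proof.
move=> nD; have [l hl] := ex_ell D; have := bound hl => dl.
by apply: dimgeW (quotient_dim_dimge hl); rewrite -lez_nat (le_trans nD).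
Qed.

(* Multiplication by f ^ N embeds L (N (pts s - A)) into L 0; if deg A < size s
   then the dimension of the former is unbounded by [riemann_dimge]. *)
Lemma size_zeros_le A s f : f != 0 -> L (A - pts s) f -> (size s)%:Z <= deg A.
Proof.
move=> f0 hf; rewrite leNgt; apply/negP => As.
(* The degree of [(pts s - A) *+ N] is at least [l + g], enough for Riemann's inequality to give [l]
   independent functions. *)
have [l hl] := RR_finite 0; pose N := (l + g)%N; apply: hl.
have hfN n : L ((A - pts s) *+ n) (f ^+ n).
  elim: n => [|n IHn]; last by rewrite mulrS exprS; apply: RR_mul.
  rewrite RR_vge => p; rewrite mulr0n coeff0 expr0; right.
  by rewrite ord_one.
apply: (@dimge_mul _ _ (L ((pts s - A) *+ N)) _ (f ^+ N)).
- by rewrite expf_neq0.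
- move=> h hh; rewrite (_ : 0 = (A - pts s) *+ N + (pts s - A) *+ N).
    exact: RR_mul.
  by rewrite -mulrnDl addrA subrK subrr mul0rn.
apply: riemann_dimge; rewrite degMn degB deg_pts.
have : (1 : int) *+ N <= ((size s)%:Z - deg A) *+ N by rewrite lerMn2r; apply/orP; right; lia.
rewrite /N natz; lia.
Qed.

(** The bound on the number of zeros provides a longest [s] with [f] in L(A - pts s). It exhausts
    the zeros: a point where the order of [f] is larger could be added to it. *)
Lemma ex_zeros A f : f != 0 -> L A f -> exists2 s,
  forall p, ord p f = coeff p (pts s) - coeff p A & (size s)%:Z <= deg A.
Proof.
move=> f0 hf.
pose P n := `[< exists2 s, size s = n & L (A - pts s) f >].
have P0 : exists n, P n.
  by exists 0%N; apply/asboolP; exists [::]; rewrite // /pts big_nil subr0.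
have Pb n : P n -> (n <= `|deg A|)%N.
  by move=> /asboolP[s <-] /(size_zeros_le f0); lia.
case: (ex_maxnP P0 Pb) => n /asboolP[s sn hs] nmax; exists s; last exact: size_zeros_le hs.
move=> p; have := RR_vge (A - pts s) f; move=> [/(_ hs) hv _].
have : coeff p (pts s) - coeff p A <= ord p f.
  case: (hv p) => [e|]; first by rewrite e eqxx in f0.
  by rewrite coeffB opprB.
rewrite le_eqVlt => /orP[/eqP ->//|lt]; exfalso.
have : P n.+1; last by move=> /nmax; rewrite ltnn.
apply/asboolP; exists (p :: s); first by rewrite /= sn.
apply/RR_vge => q; rewrite /pts big_cons -/(pts s) coeffB coeffD coeffU mul1r.
case: eqVneq => [<-|pq] /=; first by right; lia.
by rewrite add0r -coeffB.
Qed.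

(** * Gaps and the genus *)

Implicit Types P : point X.

Hypothesis genus_min : forall g' : nat, riemann_bound X g' -> (g <= g')%N.

(** By minimality [g - 1] is not a Riemann bound, which yields a divisor attaining equality in
    Riemann's inequality. *)
Lemma genus_witness : (0 < g)%N ->
  exists D l, ~ dimge (L D) l.+1 /\ l%:Z <= deg D + 1 - g%:Z.
Proof.
move=> g0; have : ~ riemann_bound X g.-1 by move=> /genus_min; lia.
move=> /existsNP[D /existsNP[l /not_implyP[hl dl]]]; exists D, l; split; last lia.
by move=> /(quotient_dim_max hl); rewrite ltnn.
Qed.

(* For m large some nonzero f lies in L (m P - D), so division by f embeds
   L (m P) in L (D + E), where E is the divisor of zeros of f relative to m P - D. *)
Lemma dimge_mult_pt P : (0 < g)%N -> exists m0 : nat, forall m n : nat, (m0 <= m)%N ->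
  dimge (L (mult_pt m P)) n -> n%:Z <= m%:Z + 1 - g%:Z.
Proof.
move=> /genus_witness[D [l [hD lD]]]; exists (`|deg D| + g)%N => m n m0m hn.
have [t Lt It] : dimge (L (mult_pt m P - D)) 1.
  by apply: riemann_dimge; rewrite degB degU; lia.
have f0 : t ord0 != 0.
  apply/eqP => e; have /(_ _ ord0)/eqP := It (fun=> 1).
  by rewrite big_ord1 e mulr0 oner_eq0 => /(_ erefl).
have [s hs ss] := ex_zeros f0 (Lt ord0).
rewrite leNgt; apply/negP => nm; apply: hD; apply: (@dimge_RR_pts _ s).
apply: (@dimgeW _ _ _ _ n).
  by move: ss; rewrite degB degU; lia.
apply: dimge_mul hn; first exact: invr_neq0 f0.
move=> h hh; rewrite (_ : D + pts s = (D - mult_pt m P + pts s) + mult_pt m P).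
  apply: RR_mul => //; apply/RR_vge => p; right.
  by rewrite ordV // hs !coeffD !coeffN; lia.
by rewrite addrAC subrK.
Qed.

(** A divisor of |mP| avoiding [P] comes from a function with a pole of exact order [m]. Conversely,
    the zeros of such a function avoid [P], and mP itself avoids every other point. *)
Lemma WS_ord P (m : nat) : WS P m <-> exists f, [/\ f != 0, L (mult_pt m P) f & ord P f = - m%:Z].
Proof.
split=> [[->|/(_ P)[E [Eeff [f hf]] EP]]|[f [f0 Lf fP]]].
- exists 1; rewrite oner_neq0; split=> //; last by rewrite ord_one.
  apply/RR_vge => p; right; rewrite ord_one coeffU; lia.
- exists f; have f0 := has_ord_neq0 (hf P); split=> //; last first.
    by rewrite (has_ord_ord (hf P)) EP coeffU eqxx mulr1 sub0r.
  apply/RR_vge => p; right; rewrite (has_ord_ord (hf p)) lerDr; exact: Eeff.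
right=> p; have [->|pP] := eqVneq p P.
  have [s hs _] := ex_zeros f0 Lf; exists (pts s).
    split=> [q|]; first by rewrite coeff_pts.
    by exists f => q; rewrite -hs; apply: ordP.
  by move: (hs P); rewrite fP coeffU eqxx; lia.
exists (mult_pt m P); last by rewrite coeffU eq_sym (negbTE pP) mulr0.
split=> [q|]; first by rewrite coeffU; case: eqP; lia.
by exists 1 => q; rewrite subrr -(ord_one q); apply/ordP/oner_neq0.
Qed.

(** Functions with distinct pole orders at [P] are independent in L(mP), whose dimension is at most
    m + 1 - g for [g] positive and [m] large. *)
Lemma card_nongaps_le P : exists m0, forall m (S : {set 'I_m.+1}), (m0 <= m)%N ->
  (forall i, i \in S -> WS P i) -> (#|S| + g <= m.+1)%N.
Proof.
have [g0|g0] := posnP g.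
  by exists 0%N => m S _ _; rewrite g0 addn0 -[leqRHS]card_ord max_card.
have [m0 hm0] := dimge_mult_pt P g0; exists m0 => m S m0m SW.
have /choice[t ht] : forall i : 'I_#|S|, exists f,
    [/\ f != 0, L (mult_pt m P) f & ord P f = - (enum_val i : nat)%:Z].
  move=> i; have /WS_ord[f [f0 Lf fP]] := SW _ (enum_valP i).
  exists f; split=> //; apply: RR_le Lf => p; rewrite !coeffU.
  by apply: ler_wpM2r; rewrite ?ler0n // lez_nat -ltnS.
have : dimge (L (mult_pt m P)) #|S|.
  exists t => [i|]; first by have [] := ht i.
  apply: (@indep_ord P) => [i|i j]; first by have [] := ht i.
  have [_ _ ->] := ht i; have [_ _ ->] := ht j.
  by move=> /oppr_inj [] /val_inj /enum_val_inj.
by move=> /(hm0 _ _ m0m); lia.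
Qed.

(** Up to a large [m] there are at least [g] gaps, all outside [S]; a non-gap [w] outside [S] would
    bring the count to [g + 1]. *)
Lemma WS_eq P (S : set nat) : (forall m, S m -> WS P m) ->
  (forall m (G : {set 'I_m}), (forall i, i \in G -> ~ S i) -> (#|G| <= g)%N) ->
  WS P = S.
Proof.
move=> SW Sg; apply/seteqP; split=> // w Ww; apply: contrapT => Sw.
have [m0 hm0] := card_nongaps_le P; pose m := maxn m0 w.
pose G : {set 'I_m.+1} := finset (fun i : 'I_m.+1 => ~~ `[< S (val i) >]).
have wm : (w < m.+1)%N by rewrite ltnS leq_maxr.
have wG : Ordinal wm \in G by rewrite inE; apply/asboolPn.
have GS i : i \in G -> ~ S i by rewrite inE => /asboolPn.
have Wle : (#|Ordinal wm |: ~: G| + g <= m.+1)%N.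
  apply: hm0; first exact: leq_maxl.
  by move=> i; rewrite !inE negbK => /predU1P[->//|/asboolP]; exact: SW.
have := Sg _ G GS; rewrite leqNgt => /negP; apply.
move: Wle; rewrite cardsU1 in_setC wG /= -[X in (_ <= X)%N](card_ord m.+1).
by rewrite -(cardsC G) addnAC leq_add2r.
Qed.

(** * Functions with prescribed poles *)

(** The product [x ^+ i * y ^+ j] realizes i a + j b, and [y ^+ i / x ^+ l] realizes i b - l a. The
    latter is regular at [Q] because l a < n(l) mu and n(l) <= i. *)
Lemma semigroup_WS P Q x y (a b mu : nat) : x != 0 -> y != 0 -> (0 < mu)%N ->
  ord P x = - a%:Z -> ord Q x = a -> (forall p, p <> P -> p <> Q -> ord p x = 0) ->
  ord P y = - b%:Z -> ord Q y = mu -> (forall p, p <> P -> 0 <= ord p y) ->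
  forall m, (semigroup2 a b `|` trivial_nongaps mu a b) m -> WS P m.
Proof.
move=> x0 y0 mu0 xP xQ xp yP yQ yp m; rewrite WS_ord.
case=> [[i [j ->]]|[l [nl [i [_ /andP[_ nlP] /andP[nli _] mE]]]]].
  exists (x ^+ i * y ^+ j).
  have oE p : ord p (x ^+ i * y ^+ j) = ord p x *+ i + ord p y *+ j.
    by rewrite ordM ?expf_neq0 // !ordX.
  split; first by rewrite mulf_neq0 ?expf_neq0.
    apply/RR_vge => p; right; rewrite oE coeffU.
    have [->|pP] := eqVneq p P; first by rewrite xP yP ?eqxx /=; lia.
    rewrite mulr0 oppr0; move/eqP in pP.
    apply: addr_ge0; apply: mulrn_wge0; last exact: yp.
    by have [->|/eqP pQ] := eqVneq p Q; rewrite ?xQ ?xp.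
  by rewrite oE xP yP; lia.
exists (y ^+ i / x ^+ l).
have oE p : ord p (y ^+ i / x ^+ l) = ord p y *+ i - ord p x *+ l.
  by rewrite ordM ?invr_neq0 ?expf_neq0 // ordV ?expf_neq0 // !ordX.
split; first by rewrite mulf_neq0 ?invr_neq0 ?expf_neq0.
  apply/RR_vge => p; right; rewrite oE coeffU.
  have [->|pP] := eqVneq p P; first by rewrite xP yP ?eqxx /= mE; lia.
  rewrite mulr0 oppr0; move/eqP in pP.
  have [->|/eqP pQ] := eqVneq p Q; last first.
    by rewrite xp // mul0rn subr0; apply: mulrn_wge0; apply: yp.
  rewrite xQ yQ; have : (nl * mu <= i * mu)%N by rewrite leq_mul2r nli orbT.
  by move: nlP; lia.
by rewrite oE xP yP mE; lia.
Qed.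

Lemma indep_fcons_powers p x h m : x != 0 -> h != 0 -> ord p x != 0 ->
  (forall i, ord p h != ord p x *+ i) -> indep (fcons h (fun i : 'I_m => x ^+ i)).
Proof.
move=> x0 h0 ox hx; apply: (@indep_ord p) => [i|i j].
  by case: (unliftP ord0 i) => [i'|] ->; rewrite ?fconsS ?fcons0 // expf_neq0.
case: (unliftP ord0 i) (unliftP ord0 j) => [i'|] -> [j'|] ->;
  rewrite ?fconsS ?fcons0 ?ordX //.
- rewrite -[in LHS]mulr_natr -[in RHS]mulr_natr => /(mulfI ox)/eqP.
  by rewrite eqr_nat => /eqP/val_inj ->.
- by move=> e; have := hx i'; rewrite e eqxx.
- by move=> e; have := hx j'; rewrite e eqxx.
Qed.

(* A function z with pole divisor at most (n+1)aP lies in the span of y0 and the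
   powers of x; comparing the orders at P and Q with the multiples of a shows that
   y0 occurs in z. *)
Lemma ex_second_function P Q x (a b n r : nat) : P <> Q -> x != 0 ->
  ord P x = - a%:Z -> ord Q x = a -> (forall p, p <> P -> p <> Q -> ord p x = 0) ->
  (0 < r < a)%N -> b = (n * a + r)%N -> WS P b -> WS Q b ->
  ~ dimge (L (mult_pt (n.+1 * a) P)) n.+4 ->
  exists y, [/\ y != 0, ord P y = - b%:Z, ord Q y = (a - r)%N
    & forall p, p <> P -> 0 <= ord p y].
Proof.
move=> PQ x0 xP xQ xp /andP[r0 ra] bE.
move=> /WS_ord[y0 [y00 Ly0 y0P]] /WS_ord[y1 [y10 Ly1 y1Q]] fin.
(* The factor [x ^+ n.+1] turns the pole of order b at [Q] into a zero of order (n+1)a - b = a - r,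
   at the cost of a pole of order at most (n+1)a at [P]. *)
pose z := y1 * x ^+ n.+1; have z0 : z != 0 by rewrite mulf_neq0 ?expf_neq0.
have xX p i : ord p (x ^+ i) = ord p x *+ i by rewrite ordX.
have xge p : p <> P -> 0 <= ord p x.
  by move=> pP; have [->|/eqP pQ] := eqVneq p Q; rewrite ?xQ ?xp.
have zQ : ord Q z = (a - r)%N by rewrite ordM ?expf_neq0 // xX y1Q xQ bE; lia.
have ordL D f p : f != 0 -> L D f -> - coeff p D <= ord p f.
  by move=> f0 /RR_vge/(_ p)[e|//]; rewrite e eqxx in f0.
have zp p : p <> P -> 0 <= ord p z.
  move=> pP; have [->|/eqP pQ] := eqVneq p Q; first by rewrite zQ.
  rewrite ordM ?expf_neq0 // xX xp // mul0rn addr0; apply: le_trans (ordL _ _ p y10 Ly1).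
  by rewrite coeffU; case: eqP => [e|_]; [case: pQ | rewrite mulr0 oppr0].
have Lz : L (mult_pt (n.+1 * a) P) z.
  apply/RR_vge => p; have [->|/eqP pP] := eqVneq p P.
    right; rewrite coeffU ?eqxx ordM ?expf_neq0 // xX xP.
    have := ordL _ _ P y10 Ly1; rewrite coeffU; case: eqP => [e|_]; last lia.
    by case: PQ.
  right; rewrite coeffU; case: eqP => [e|_]; first by case: pP.
  by rewrite mulr0 oppr0; apply: zp.
have Ly0' : L (mult_pt (n.+1 * a) P) y0.
  by apply: RR_le Ly0 => p; rewrite !coeffU; case: eqP => _; lia.
have LX (i : 'I_n.+2) : L (mult_pt (n.+1 * a) P) (x ^+ i).
  apply/RR_vge => p; right; rewrite coeffU xX; have := ltn_ord i.
  have [->|/eqP pP] := eqVneq p P; first by rewrite xP ?eqxx /=; nia.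
  by rewrite /= mulr0 oppr0 mulrn_wge0 // xge.
(* At [P] the order of [y0] is not a multiple of [a], unlike those of the powers of [x]. *)
have indP : indep (fcons y0 (fun i : 'I_n.+2 => x ^+ i)).
  apply: (@indep_fcons_powers P) => // [|i]; first by rewrite xP; lia.
  by rewrite y0P xP bE; apply/eqP; have [?|?] := leqP i n; nia.
(* At [Q] the order a - r of [z] lies strictly between 0 and [a]. *)
have indQ : indep (fcons z (fun i : 'I_n.+2 => x ^+ i)).
  apply: (@indep_fcons_powers Q) => // [|i]; first by rewrite xQ; lia.
  by rewrite zQ xQ; apply/eqP; case: i => [|i]; nia.
(* [z], [y0] and the n + 2 powers of [x] are too many to be independent in L((n+1)aP). *)
have [c hc [i ci]] : exists2 c : 'I_n.+4 -> k,
    cst (c ord0) * z + (cst (c (lift ord0 ord0)) * y0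
      + \sum_(i < n.+2) cst (c (lift ord0 (lift ord0 i))) * x ^+ i) = 0
    & exists i, c i != 0.
  apply: contrapT => nc; apply: fin.
  exists (fcons z (fcons y0 (fun i : 'I_n.+2 => x ^+ i))).
    move=> i; case: (unliftP ord0 i) => [j|] ->; rewrite ?fconsS ?fcons0 //.
    by case: (unliftP ord0 j) => [j'|] ->; rewrite ?fconsS ?fcons0.
  move=> c; rewrite big_ord_recl fcons0 big_ord_recl fconsS fcons0.
  under eq_bigr do rewrite !fconsS.
  move=> hc i; apply: contrapT => /eqP ci; apply: nc; exists c => //; by exists i.
have cz : c ord0 != 0.
  apply: contra_neq ci => c0; move: hc; rewrite c0 rmorph0 mul0r add0r => hc.
  have := indP (fun i => c (lift ord0 i)).
  rewrite big_ord_recl fcons0; under eq_bigr do rewrite fconsS.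
  by move=> /(_ hc) hc'; case: (unliftP ord0 i) => [j|] ->.
have cy : c (lift ord0 ord0) != 0.
  apply/eqP => c1; move: hc; rewrite c1 rmorph0 mul0r add0r => hc.
  have := indQ (fun i => oapp (fun j => c (lift ord0 (lift ord0 j))) (c ord0) (unlift ord0 i)).
  rewrite big_ord_recl fcons0 unlift_none; under eq_bigr do rewrite fconsS liftK.
  by move=> /(_ hc) /(_ ord0); rewrite unlift_none /=; apply/eqP.
have ccz : cst (c ord0) != 0 by rewrite fmorph_eq0.
pose d (i : 'I_n.+2) := c (lift ord0 (lift ord0 i)).
(* Only the top power of [x] joins [z]. By the relation, [y] is a multiple of [y0] plus powers of
   exponent at most n, with poles of order at most na < b at [P]. At [Q] the top power vanishes to
   order (n+1)a > a - r, so [z] decides. *)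
pose y := cst (c ord0) * z + cst (d ord_max) * x ^+ n.+1.
have yE : y = - (cst (c (lift ord0 ord0)) * y0)
    + - \sum_(i < n.+1) cst (d (widen_ord (leqnSn _) i)) * x ^+ i.
  move: hc; rewrite big_ord_recr /= => hc.
  apply/eqP; rewrite -subr_eq0 -[X in _ == X]hc /y opprD !opprK /d.
  by apply/eqP; ring.
have ccy : - (cst (c (lift ord0 ord0)) * y0) != 0.
  by rewrite oppr_eq0 mulf_neq0 // fmorph_eq0.
have oN p f : f != 0 -> ord p (- f) = ord p f.
  by move=> f0; rewrite -mulN1r -(rmorphN1 cst) ordM ?fmorph_eq0 ?oppr_eq0 ?oner_neq0 // ordC ?add0r ?oppr_eq0 ?oner_neq0.
have oy0 : ord P (- (cst (c (lift ord0 ord0)) * y0)) = - b%:Z.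
  rewrite oN; last by rewrite -oppr_eq0.
  by rewrite ordM ?fmorph_eq0 // ordC // add0r.
have [yn0 yP] : y != 0 /\ ord P y = - b%:Z.
  rewrite yE -oy0; apply: ordDl => //; rewrite oy0; apply/vgeN/vge_sum => j _.
  by apply: vgeZ; right; rewrite xX xP bE; have := ltn_ord j; nia.
exists y; split=> //.
  have ocz : ord Q (cst (c ord0) * z) = (a - r)%N by rewrite ordM // ordC // add0r.
  rewrite -ocz; apply: (ordDl _ _).2; first by rewrite mulf_neq0.
  by apply: vgeZ; right; rewrite ocz xX xQ; nia.
move=> p pP; have : vge p 0 y.
  apply: vgeD; apply: vgeZ; right; first exact: zp.
  by rewrite xX mulrn_wge0 // xge.
by case=> // e; rewrite e eqxx in yn0.
Qed.

End FiniteDim.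

End Valuation.

(** * Counting the gaps *)

Section Combinatorics.
Implicit Types a b c i m x : nat.

(** The remainders of i c and (a - i) c modulo [a] are nonzero and add up to [a]. *)
Lemma divn_pair a c i : coprime a c -> (0 < i < a)%N ->
  (i * c %/ a + (a - i) * c %/ a = c.-1)%N.
Proof.
move=> ac /andP[i0 ia]; have a0 : (0 < a)%N by lia.
have s0 : (0 < i * c %% a)%N.
  rewrite lt0n; apply/negP; rewrite -/(dvdn a (i * c)) mulnC Gauss_dvdr // => /(dvdn_leq i0).
  by lia.
have sa := ltn_pmod (i * c) a0; have e := divn_eq (i * c) a.
have qc : (i * c %/ a < c)%N.
  by rewrite ltn_divLR // mulnC ltn_pmul2l //; case: c e s0 {ac sa} => //; rewrite muln0 mod0n.
have -> : ((a - i) * c = (c.-1 - i * c %/ a) * a + (a - i * c %% a))%N.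
  have h : (a * c = a + i * c %/ a * a + (c.-1 - i * c %/ a) * a)%N.
    move: (i * c %/ a)%N qc => q; case: c {ac s0 sa e} => // c qc /=.
    by rewrite -addnA -mulnDl subnKC // mulnS mulnC.
  rewrite mulnBl h; move: e sa.
  move: (i * c)%N (i * c %/ a)%N (i * c %% a)%N => n q d.
  by move: (_ * a)%N (q * a)%N => D e; lia.
have sm : (a - i * c %% a < a)%N by rewrite ltn_subrL s0 a0.
rewrite divnMDl // (divn_small sm) addn0.
by move: (i * c %/ a)%N qc => q; lia.
Qed.

(** The classical floor sum, obtained by pairing i with a - i. *)
Lemma sum_divn a c : (0 < a)%N -> (0 < c)%N -> coprime a c ->
  (2 * \sum_(i < a) (i * c %/ a) = a.-1 * c.-1)%N.
Proof.
case: a => // a _ c0 ac; rewrite big_ord_recl mul0n div0n add0n mul2n -addnn.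
rewrite {2}(reindex_inj rev_ord_inj) /= -big_split /=.
rewrite (eq_bigr (fun=> c.-1)) => [|i _].
  by rewrite sum_nat_const card_ord.
rewrite -(@divn_pair a.+1 c i.+1) //; last by rewrite /= ltnS ltn_ord.
by rewrite /bump /= !add1n subSS; congr (_ + _ * _ %/ _)%N; have := ltn_ord i; lia.
Qed.

Lemma residue_multiple a b x : (0 < a)%N -> (0 < b)%N -> coprime a b ->
  exists2 i, (i < a)%N & i * b = x %[mod a].
Proof.
move=> a0 b0; rewrite coprime_sym => /(coprimeP _ b0)[[u v] /= uv].
exists ((x * u) %% a)%N; first exact: ltn_pmod.
rewrite modnMml -mulnA (_ : u * b = 1 + v * a)%N; last lia.
by rewrite mulnDr muln1 mulnA addnC modnMDl.
Qed.

Variables a b mu : nat.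
Hypotheses (mu_bounds : (0 < mu < a)%N) (mu_b : (mu <= b)%N).
Hypotheses (ab : coprime a b) (amu : coprime a mu).

Local Notation S := (semigroup2 a b `|` trivial_nongaps mu a b).

(** Choose i < a with x congruent to i b modulo [a]. Outside the semigroup, x = i b - m a with m >
    0; outside the trivial non-gaps, m exceeds the integer part of i mu / a, and [q] measures the
    excess minus one. *)
Lemma gap_form x : ~ S x -> exists i q,
  [/\ (i < a)%N, (q < i * b %/ a - i * mu %/ a)%N
    & x = (i * b - (i * mu %/ a + q.+1) * a)%N].
Proof.
have [mu0 mua] := andP mu_bounds.
have a0 : (0 < a)%N by lia.
have b0 : (0 < b)%N by lia.
move=> nS; have [i ia ix] := residue_multiple x a0 b0 ab.
have xi : (x < i * b)%N.
  rewrite ltnNge; apply/negP => ibx; apply: nS; left.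
  have /dvdnP[j e] : (a %| x - i * b)%N by rewrite -eqn_mod_dvd // ix.
  by exists j, i; lia.
have /dvdnP[m e] : (a %| i * b - x)%N by rewrite -eqn_mod_dvd ?ix // ltnW.
have m0 : (0 < m)%N by case: m e => //; lia.
have i0 : (0 < i)%N by case: i xi {ix ia e}.
have [ma|ma] := ltnP (m * a) (i * mu).
  (* Here n(m) is the integer part of m a / mu, plus one; the strict lower inequality holds since
     [a] and [mu] are coprime and 0 < m < mu. *)
  case: nS; right; exists m, (m * a %/ mu).+1, i.
  have mmu : (m < mu)%N by rewrite -(ltn_pmul2r a0) (leq_trans ma) // mulnC leq_mul2l ltnW ?orbT.
  have lt1 : (m * a %/ mu * mu < m * a)%N.
    rewrite ltn_neqAle leq_trunc_div andbT; apply/negP => /eqP h.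
    have : (mu %| m * a)%N by apply/dvdnP; exists (m * a %/ mu)%N.
    by rewrite Gauss_dvdl 1?coprime_sym // => /(dvdn_leq m0); lia.
  split.
  - lia.
  - by rewrite {1}intS addrAC subrr add0r -!PoszM !ltz_nat lt1 ltn_ceil.
  - by rewrite ltn_divLR // ma /=; lia.
  - lia.
(* Equality m a = i mu is excluded by coprimality, as 0 < i < a. *)
have imu : (i * mu %/ a < m)%N.
  rewrite ltn_divLR // ltn_neqAle ma andbT; apply/negP => /eqP h.
  have : (a %| i * mu)%N by rewrite h dvdn_mull.
  by rewrite Gauss_dvdl // => /(dvdn_leq i0); lia.
have mib : (m <= i * b %/ a)%N by rewrite leq_divRL //; lia.
exists i, (m - (i * mu %/ a).+1)%N; split=> //; first lia.
have -> : (i * mu %/ a + (m - (i * mu %/ a).+1).+1 = m)%N by lia.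
lia.
Qed.

(** The gap candidates number the sum over i < a of the differences of the integer parts of i b / a
    and i mu / a; two floor sums evaluate it. *)
Lemma card_gaps_le m (G : {set 'I_m}) : (forall i : 'I_m, i \in G -> ~ S i) ->
  (2 * #|G| <= a.-1 * (b - mu))%N.
Proof.
have [mu0 mua] := andP mu_bounds.
have a0 : (0 < a)%N by lia.
have b0 : (0 < b)%N by lia.
move=> GS; pose s := [seq (i * b - (i * mu %/ a + q.+1) * a)%N
  | i <- iota 0 a, q <- iota 0 (i * b %/ a - i * mu %/ a)].
have sub : {subset map val (enum G) <= s}.
  move=> x /mapP[y]; rewrite mem_enum => /GS/gap_form[i [q [ia qlt e]]] xE.
  rewrite xE [val y]e; apply/allpairsPdep; exists i, q.
  by rewrite !mem_iota.
have Gu : uniq (map val (enum G)) by rewrite (map_inj_uniq val_inj) enum_uniq.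
have := uniq_leq_size Gu sub; rewrite size_map -cardE => Gs.
suff <- : (2 * size s = a.-1 * (b - mu))%N by rewrite leq_mul2l Gs.
rewrite size_allpairs_dep sumnE big_map -[X in iota 0 X]subn0 -/(index_iota 0 a) big_mkord.
rewrite (eq_bigr (fun i : 'I_a => i * b %/ a - i * mu %/ a)%N) => [|i _]; last first.
  by rewrite size_iota.
have e : (\sum_(i < a) (i * b %/ a - i * mu %/ a) + \sum_(i < a) (i * mu %/ a)
          = \sum_(i < a) (i * b %/ a))%N.
  rewrite -big_split; apply: eq_bigr => i _ /=; rewrite subnK //.
  by rewrite leq_div2r // leq_mul2l mu_b orbT.
have h1 := sum_divn a0 b0 ab; have h2 := sum_divn a0 mu0 amu.
rewrite -e mulnDr h2 in h1.
have -> : (b - mu = b.-1 - mu.-1)%N by lia.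
by rewrite mulnBr -h1 addnK.
Qed.

End Combinatorics.

(** * Both points have the same non-gaps *)

(** A zero uniformizer would make the maximal ideal zero, against the positive dimension of its
    quotient by its square. *)
Lemma smooth_uniformizer_neq0 (k : closedFieldType) (X : projVariety k) (d : nat)
  (p : point X) (t : pv_field X) :
  smooth_of_dim X d.+1 -> uniformizer p t -> t != 0.
Proof.
move=> [_ /(_ p)[s [Ms _ indep_s]]] [_ Ut]; apply/eqP => t0.
have s0 : s ord0 = 0 by have [g _ ->] := Ut _ (Ms ord0); rewrite t0 mul0r.
have := indep_s (fun i => (i == ord0)%:R); have -> : \sum_(i < d.+1)
    pv_const X (i == ord0)%:R * s i = 0.
  by rewrite big1 // => i _; have [->|] := eqVneq i ord0; rewrite ?s0 ?mulr0 // rmorph0 mul0r.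
have M0 : max_ideal_sq p 0 by exists 0%N, (fun=> 0), (fun=> 0); split=> [[]|[]|] //; rewrite big_ord0.
by move=> /(_ M0 ord0)/eqP; rewrite eqxx oner_eq0.
Qed.

Theorem corollary11 (R : realType) (C : projVariety R[i]) (P : point C)
  (g a b n r : nat)
  (C_smooth : smooth_curve C)
  (C_genus : has_genus C g)
  (a_first : first_nongap P a)
  (b_first : first_nongap_not_multiple P a b)
  (b_eq : b = (n * a + r)%N)
  (n_ge1 : (1 <= n)%N)
  (r_bounds : (0 < r < a)%N)
  (ab_coprime : coprime a b)
  (dim_eq : lin_system_dim (mult_pt (n.+1 * a) P) (n + 2)%N%:Z)
  (g_eq : g%:Q = (a%:Q - 1) * (b%:Q - a%:Q + r%:Q) / 2)
  (Q : point C)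
  (Q_neq_P : Q <> P)
  (Q_weierstrass : weierstrass_point g Q)
  (Q_a : WS Q a)
  (Q_b : WS Q b)
  (aQ_aP : lin_system (mult_pt a P) (mult_pt a Q)) :
  WS P = WS Q /\
  WS P = semigroup2 a b `|` trivial_nongaps (a - r) a b /\
  WS Q = semigroup2 a b `|` trivial_nongaps (a - r) a b.

Proof.
have alg_dep2 := C_smooth.1.2.
have [_ [x hx]] := aQ_aP.
(* Uniformizers come from [x]: having an order at [p] includes the existence of one. *)
have ex_unif (p : point C) : exists2 t, uniformizer p t & t != 0.
  have [t [_ [Ut _ _ _ _]]] := hx p.
  by exists t => //; apply: smooth_uniformizer_neq0 C_smooth Ut.
have [l hl ln] := dim_eq.
have fin : ~ dimge (riemann_roch_space (mult_pt (n.+1 * a) P)) n.+4.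
  by move=> /(quotient_dim_max hl); lia.
have [bound genus_min] := C_genus.
have x0 := has_ord_neq0 ex_unif (hx P).
have ordx p : ord p x = coeff p (mult_pt a Q) - coeff p (mult_pt a P).
  exact: has_ord_ord.
have PQ : P <> Q by move=> e; case: Q_neq_P.
have xP : ord P x = - a%:Z.
  by rewrite ordx !coeffU eqxx (negbTE (introN eqP Q_neq_P)) mulr0 mulr1 sub0r.
have xQ : ord Q x = a.
  by rewrite ordx !coeffU eqxx (negbTE (introN eqP PQ)) mulr0 mulr1 subr0.
have xp p : p <> P -> p <> Q -> ord p x = 0.
  move=> pP pQ; rewrite ordx !coeffU; case: eqP => [e|_]; first by case: pQ.
  by case: eqP => [e|_]; [case: pP | rewrite !mulr0 subr0].
have [b_WS _ _] := b_first; have [r0 ra] := andP r_bounds.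
have [y [y0 yP yQ yp]] := ex_second_function alg_dep2 ex_unif fin bound PQ x0 xP xQ xp
  r_bounds b_eq b_WS Q_b fin.
pose mu := (a - r)%N; have mu0 : (0 < mu)%N by rewrite subn_gt0.
have mua : (0 < mu < a)%N by rewrite mu0 /mu; lia.
have mub : (mu <= b)%N by rewrite b_eq /mu; nia.
(* Modulo [a], b is congruent to r and a - r to -r. *)
have amu : coprime a mu.
  have cop u v : coprime (u + v) u -> coprime (u + v) v.
    by rewrite /coprime gcdnC gcdnDl [gcdn (u + v) v]gcdnC gcdnDr gcdnC.
  rewrite -(subnKC (ltnW ra)); apply: cop; rewrite subnKC ?(ltnW ra) //.
  by move: ab_coprime; rewrite b_eq /coprime gcdnMDl.
have gaps m (G : {set 'I_m}) : (forall i : 'I_m, i \in G ->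
    ~ (semigroup2 a b `|` trivial_nongaps mu a b) i) -> (#|G| <= g)%N.
  move=> /(card_gaps_le mua mub ab_coprime amu).
  (* This is the assumed genus formula, since b - mu = b - a + r; it is checked over the
     rationals. *)
  suff -> : (a.-1 * (b - mu) = 2 * g)%N by rewrite leq_mul2l.
  apply/eqP; rewrite -(eqr_nat rat) !natrM; apply/eqP.
  have -> : g%:R = (a%:R - 1) * (b%:R - a%:R + r%:R) / 2 :> rat := g_eq.
  have a1 : a.-1%:R = a%:R - 1 :> rat by rewrite -subn1 natrB //; lia.
  rewrite a1 natrB // natrB ?(ltnW ra) //.
  by field.
have WSP : WS P = semigroup2 a b `|` trivial_nongaps mu a b.
  apply: (WS_eq alg_dep2 ex_unif fin bound genus_min) gaps => m.
  exact: (semigroup_WS alg_dep2 ex_unif fin bound x0 y0 mu0 xP xQ xp yP yQ yp).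
suff WSQ : WS Q = semigroup2 a b `|` trivial_nongaps mu a b by rewrite WSP WSQ.
apply: (WS_eq alg_dep2 ex_unif fin bound genus_min) gaps => m.
(* The roles of [P] and [Q] are exchanged, with 1/x and y / x^(n+1). The latter has order (a - r) -
   (n+1)a = -b at [Q] and (n+1)a - b = a - r at [P]. *)
have xX0 : x ^+ n.+1 != 0 by rewrite expf_neq0.
have oy p : ord p (y / x ^+ n.+1) = ord p y - ord p x *+ n.+1.
  by rewrite (ordM alg_dep2 ex_unif) ?invr_neq0 // (ordV alg_dep2 ex_unif) // (ordX alg_dep2 ex_unif).
have ox p : ord p x^-1 = - ord p x by rewrite (ordV alg_dep2 ex_unif).
apply: (semigroup_WS alg_dep2 ex_unif fin bound (invr_neq0 x0) (mulf_neq0 y0 (invr_neq0 xX0)) mu0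
  (Q := P)).
- by rewrite ox xQ.
- by rewrite ox xP opprK.
- by move=> p pQ pP; rewrite ox xp ?oppr0.
- by rewrite oy yQ xQ /mu b_eq; nia.
- by rewrite oy yP xP /mu b_eq; nia.
- move=> p pQ; rewrite oy; have [->|/eqP pP] := eqVneq p P.
    by rewrite yP xP b_eq; nia.
  by rewrite xp // mul0rn subr0; apply: yp.
Qed.
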